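(* Let $I\subseteq\mathbb{R}$ be an interval and let $A$ be a self-adjoint operator on $\mathcal{H}$ with $Sp(A)\subseteq[m,M]\subset I$ for some $m<M$. If $f:[m,M]\to(0,\infty)$ is a continuous twice differentiable function such that $\alpha\le f''$ on $[m,M]$, where $\alpha\in\mathbb{R}$, and if $\Phi:\mathcal{B}(\mathcal{H})\to\mathcal{B}(\mathcal{K})$ is a unital positive linear map, then $$\frac{1}{K(m,M,f)}\left\{\Phi(f(A))+\frac{\alpha}{2}\left[(M+m)\Phi(A)-Mm-\Phi(A^2)\right]\right\}\le f(\Phi(A))$$ and $$f(\Phi(A))\le K(m,M,f)\,\Phi(f(A))-\frac{\alpha}{2}\left[(M+m)\Phi(A)-Mm-\Phi(A)^2\right],$$ where $$K(m,M,f)=\max\left\{\frac{1}{f(t)}\left(\frac{M-t}{M-m}f(m)+\frac{t-m}{M-m}f(M)\right):t\in[m,M]\right\}.$$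
   Context: $\mathcal{H},\mathcal{K}$ are Hilbert spaces and $\mathcal{B}(\mathcal{H})$, $\mathcal{B}(\mathcal{K})$ are the algebras of bounded linear operators on them. A linear map $\Phi$ is positive if it maps positive (semidefinite) operators to positive operators, and unital if $\Phi$ maps the identity to the identity. $Sp(A)$ is the spectrum of $A$, $f(A)$ is the continuous functional calculus, $\le$ is the Loewner order on self-adjoint operators, and scalars in operator expressions denote multiples of the identity. $\Phi(A)^2$ means $(\Phi(A))^2$. *)

(* Defs.v *)
From HB Require Import structures.
From mathcomp Require Import all_boot all_order all_algebra complex.
From mathcomp Require Import all_classical all_reals all_analysis.

Set Implicit Arguments.
Unset Strict Implicit.
Unset Printing Implicit Defensive.

Import Order.TTheory GRing.Theory Num.Theory.
Import numFieldNormedType.Exports.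
Local Open Scope classical_set_scope.
Local Open Scope complex_scope.
Local Open Scope ring_scope.

(* Complex Hilbert spaces; the inner product is linear in its first argument.
   Norms take values in [R[i]], where [0 <= z] means that [z] is real and
   nonnegative, so [innerxx] also yields positive definiteness. *)
HB.mixin Record isHilbert (R : realType) H & CompleteNormedModule R[i] H := {
  inner : H -> H -> R[i];
  inner_linearl : forall (a : R[i]) (x y z : H),
    inner (a *: x + y) z = a * inner x z + inner y z;
  inner_conj : forall x y : H, inner y x = Num.conj (inner x y);
  innerxx : forall x : H, inner x x = `|x| ^+ 2 }.

#[short(type="hilbertType")]
HB.structure Definition Hilbert (R : realType) :=
  { H of CompleteNormedModule R[i] H & isHilbert R H }.

Section BoundedOperators.
Context {R : realType} {H : hilbertType R}.

Definition bounded_operator : {pred H -> H} := fun f =>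
  `[< linear f /\ exists c : R[i], forall x, `|f x| <= c * `|x| >].

Lemma bounded_operatorP (f : H -> H) : reflect
  (linear f /\ exists c : R[i], forall x, `|f x| <= c * `|x|)
  (f \in bounded_operator).
Proof. exact: asboolP. Qed.

Fact bounded_operator_submod_closed : submod_closed bounded_operator.
Proof.
split.
  have E0 x : (0 : H -> H) x = 0 by [].
  apply/bounded_operatorP; split.
    by move=> a x y; rewrite !E0 scaler0 addr0.
  by exists 0 => x; rewrite E0 normr0 mul0r.
move=> a f g /bounded_operatorP[lf [c hc]] /bounded_operatorP[lg [d hd]].
have E x : (a *: f + g) x = a *: f x + g x by [].
apply/bounded_operatorP; split.
  move=> b x y; rewrite !E lf lg !scalerDr !scalerA [a * b]mulrC.
  by rewrite addrACA.
exists (`|a| * c + d) => x; rewrite E mulrDl.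
apply: (le_trans (ler_normD _ _)); rewrite lerD// normrZ -mulrA.
by rewrite ler_wpM2l.
Qed.

HB.instance Definition _ :=
  GRing.isSubmodClosed.Build R[i] (H -> H) bounded_operator
    bounded_operator_submod_closed.

Fact bounded_operator_id : idfun \in bounded_operator.
Proof. by apply/bounded_operatorP; split=> //; exists 1 => x; rewrite mul1r. Qed.

Fact bounded_operator_comp f g : f \in bounded_operator ->
  g \in bounded_operator -> f \o g \in bounded_operator.
Proof.
move=> /bounded_operatorP[lf [c hc]] /bounded_operatorP[lg [d hd]].
apply/bounded_operatorP; split; first by move=> a x y; rewrite /= lg lf.
have nn (x : H) : `|c * `|x| | = `|c| * `|x| by rewrite normrM normr_id.
exists (`|c| * d) => x /=.
have h y : `|f y| <= `|c| * `|y|.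
  rewrite -nn; apply: (le_trans (hc y)); rewrite real_ler_norm//.
  by rewrite ger0_real// (le_trans _ (hc y)).
by rewrite (le_trans (h _))// -mulrA ler_wpM2l.
Qed.

End BoundedOperators.

Record operator (R : realType) (H : hilbertType R) := Operator {
  opfun :> H -> H;
  _ : opfun \in bounded_operator }.

Notation "''B' ( H )" := (operator H)
  (at level 8, H at level 2, format "''B' ( H )") : type_scope.

Section OperatorAlgebra.
Context {R : realType} {H : hilbertType R}.

HB.instance Definition _ := [isSub for @opfun R H].
HB.instance Definition _ := [Choice of 'B(H) by <:].
HB.instance Definition _ := [SubChoice_isSubLmodule of 'B(H) by <:].

Definition op1 : 'B(H) := Operator bounded_operator_id.
Definition op_comp (A B : 'B(H)) : 'B(H) :=
  Operator (bounded_operator_comp (valP A) (valP B)).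

Fact op_compA : associative op_comp.
Proof. by move=> A B C; apply/val_inj. Qed.
Fact op_comp1l : left_id op1 op_comp.
Proof. by move=> A; apply/val_inj. Qed.
Fact op_comp1r : right_id op1 op_comp.
Proof. by move=> A; apply/val_inj. Qed.
Fact op_compDl : left_distributive op_comp +%R.
Proof. by move=> A B C; apply/val_inj. Qed.
Fact op_compDr : right_distributive op_comp +%R.
Proof.
move=> A B C; apply/val_inj/funext => x /=.
have [lA _] := bounded_operatorP _ (valP A).
by have := lA 1 (B x) (C x); rewrite !scale1r.
Qed.

(* Possibly zero ring: the zero Hilbert space is allowed. *)
HB.instance Definition _ := GRing.Zmodule_isPzRing.Build 'B(H)
  op_compA op_comp1l op_comp1r op_compDl op_compDr.

End OperatorAlgebra.

Section OperatorTheory.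
Context {R : realType} {H : hilbertType R}.
Implicit Types A B : 'B(H).

Definition scalar_op (z : R[i]) : 'B(H) := z *: (1 : 'B(H)).

Definition selfadjoint A := forall x y : H, inner (A x) y = inner x (A y).

(* The order of [R[i]] makes this say that each [inner (A x) x] is real and
   nonnegative. *)
Definition positive_op A := forall x : H, 0 <= inner (A x) x.

Definition loewner_le A B := positive_op (B - A).

Definition spectrum A : set R[i] :=
  [set z | ~ exists B,
     B * (A - scalar_op z) = 1 /\ (A - scalar_op z) * B = 1].

Definition opnorm A : R :=
  sup [set complex.Re `|A x| | x in [set x : H | `|x| <= 1]].

Definition op_horner (p : {poly R}) A : 'B(H) :=
  \sum_(i < size p) (p`_i)%:C *: A ^+ i.

(* [B] is a norm limit of operators [p A], for real polynomials [p] converging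
   to [f] uniformly on the spectrum. *)
Definition is_cfc (f : R -> R) A B := forall e : R, 0 < e ->
  exists p : {poly R},
    (forall t : R, spectrum A t%:C -> `|f t - p.[t]| <= e) /\
    opnorm (op_horner p A - B) <= e.

(* Continuous functional calculus [f(A)], for [A] self-adjoint and [f] real
   and continuous on the spectrum of [A]: the unique [B] with [is_cfc f A B].
   Outside this case the value may be the default [0]. *)
Definition cfc (f : R -> R) A : 'B(H) := xget 0 (is_cfc f A).

End OperatorTheory.

Notation "A <=L B" := (loewner_le A B) (at level 70, no associativity).

Section PositiveMaps.
Context {R : realType} {H K : hilbertType R}.

Definition positive_map (Phi : 'B(H) -> 'B(K)) :=
  forall A, positive_op A -> positive_op (Phi A).

Definition unital_map (Phi : 'B(H) -> 'B(K)) := Phi 1 = 1.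

End PositiveMaps.

Section RealFunctions.
Context {R : realType}.

(* Differentiation of a function whose domain is [D]: difference quotients
   only use points of [D], so the derivative is one-sided at the end points
   when [D] is a compact interval. *)
Definition derivable_in (D : set R) (f : R -> R) := forall x, D x ->
  cvg ((f y - f x) / (y - x) @[y --> within D x^']).

Definition derive_in (D : set R) (f : R -> R) (x : R) : R :=
  lim ((f y - f x) / (y - x) @[y --> within D x^']).

Definition twice_derivable_in (D : set R) (f : R -> R) :=
  derivable_in D f /\ derivable_in D (derive_in D f).

(* When [f] is positive and continuous on [`[m, M]], the quotient is continuous
   there and this supremum is a maximum. *)
Definition Kmax (m M : R) (f : R -> R) : R :=
  sup [set (f t)^-1 * ((M - t) / (M - m) * f m + (t - m) / (M - m) * f M)
      | t in `[m, M]].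

End RealFunctions.

(* Main.v *)
Require Import Defs.
From mathcomp Require Import all_boot all_order all_algebra complex.
From mathcomp Require Import all_classical all_reals all_analysis.
From mathcomp Require Import ring lra.

Import Order.TTheory GRing.Theory Num.Theory.
Import numFieldNormedType.Exports.
Local Open Scope classical_set_scope.
Local Open Scope complex_scope.
Local Open Scope ring_scope.

(* On [m, M] the function f - (alpha/2) t^2 is convex, so f lies below the
   polynomial P(t) = L(t) - (alpha/2) (M - t)(t - m), where L is the chord of f,
   while L <= K f by the choice of K. Applying P - f >= 0 and K f - L >= 0 to A
   or to Phi(A), and using that Phi is monotone, unital and satisfies
   Phi(L(A)) = L(Phi(A)), gives both inequalities.

   The functional calculus enters only through its order properties, which rest
   on one fact: a real polynomial that is nonnegative on the spectrum of a
   self-adjoint operator is nonnegative at that operator. To prove it, factor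
   p - t over the complex numbers for t < 0; hence t is not in the spectrum of
   p(A), and a self-adjoint operator whose spectrum has no negative point is
   positive. *)

(** * Polynomial approximation and convexity on a segment *)

(** Heine-Cantor, from the covering form of compactness applied to the filter [0^'+] of candidate
    moduli. *)
Lemma segment_unif_continuous (R : realType) (a b : R) (f : R -> R) (e : R) :
  {within `[a, b], continuous f} -> 0 < e ->
  exists2 d : R, 0 < d & forall y z, y \in `[a, b] -> z \in `[a, b] ->
    `|y - z| < d -> `|f y - f z| <= e.
Proof.
move=> fc e0.
pose P (d y : R) := y \in `[a, b] -> forall z, z \in `[a, b] ->
  `|y - z| < d -> `|f y - f z| <= e.
have /compact_near_coveringP/(_ R 0^'+ P) H := @segment_compact R a b.
have [d [d0 Pd]] : exists d, 0 < d /\ `[a, b] `<=` P d.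
  suff : \forall d \near 0^'+, 0 < d /\ `[a, b] `<=` P d by apply: filter_ex.
  apply: filterI; first exact: nbhs_right_gt.
  apply: H => x xab.
  have /cvgrPdist_lt/(_ (e / 2)) := (subspace_continuousP `[a, b] f).1 fc x xab.
  move=> /(_ (divr_gt0 e0 (ltr0Sn _ 1))); rewrite near_withinE => /nbhs_ballP[r /= r0 xr].
  (* With half the radius, [y] near [x] and [z] near [y] both stay within [r] of [x]. *)
  exists (ball x (r / 2), [set d | d < r / 2]) => /=.
    have r20 : 0 < r / 2 by rewrite divr_gt0.
    by split; [exact: nbhsx_ballx|exact: nbhs_right_lt].
  move=> [y d] /= [xy dr] yab z zab yz.
  have fy : `|f x - f y| < e / 2.
    by apply: xr => //; rewrite -ball_normE/=; move: xy; rewrite -ball_normE/=; lra.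
  have fz : `|f x - f z| < e / 2.
    apply: xr => //; rewrite -ball_normE/=; move: xy; rewrite -ball_normE/=.
    by have := ler_distD y x z; lra.
  by have := ler_distD (f x) (f y) (f z); rewrite (distrC (f y) (f x)); lra.
by exists d => // y z yab zab; exact: Pd.
Qed.

(** Below a uniform modulus [d] the term [e] suffices; beyond it [(y - z) ^+ 2 / d ^+ 2] is at least
    1, so the total oscillation of [f] can serve as numerator of [C]. A quadratic error is one whose
    Bernstein mean is explicit. *)
Lemma segment_quadratic_modulus (R : realType) (a b : R) (f : R -> R) (e : R) :
  a <= b -> {within `[a, b], continuous f} -> 0 < e ->
  exists2 C : R, 0 <= C & forall y z, y \in `[a, b] -> z \in `[a, b] ->
    `|f y - f z| <= e + C * (y - z) ^+ 2.
Proof.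
move=> ab fc e0; have [d d0 fd] := segment_unif_continuous _ _ _ _ _ fc e0.
have [c1 c1ab f1] := EVT_max ab fc; have [c2 c2ab f2] := EVT_min ab fc.
have D0 : 0 <= f c1 - f c2 by rewrite subr_ge0 f1.
exists ((f c1 - f c2) / d ^+ 2); first by rewrite divr_ge0// sqr_ge0.
move=> y z yab zab; have [yz|yz] := ltP `|y - z| d.
  apply: (le_trans (fd _ _ yab zab yz)).
  by rewrite lerDl mulr_ge0// ?sqr_ge0// divr_ge0// sqr_ge0.
have h : `|f y - f z| <= f c1 - f c2.
  by rewrite ler_norml; have := (f1 _ yab, f2 _ yab, f1 _ zab, f2 _ zab) => -[[[]]]; lra.
apply: (le_trans h); apply: ler_wpDl; first exact: ltW.
rewrite -mulrA ler_peMr// mulrC ler_pdivlMr ?exprn_gt0// mul1r.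
by rewrite -[leRHS]real_normK ?num_real// lerXn2r// ?nnegrE// ltW.
Qed.

(* With [L.[t] = s], [(bernstein L n g).[t]] is the expectation of [g] at the
   number of successes among [n] independent trials of probability [s]. *)
Fixpoint bernstein (R : comNzRingType) (L : {poly R}) n (g : nat -> R) : {poly R} :=
  if n is n'.+1 then
    L * bernstein R L n' (g \o succn) + (1 - L) * bernstein R L n' g
  else (g 0)%:P.
Arguments bernstein {R}.

Section Bernstein.
Variables (R : realFieldType) (L : {poly R}) (t : R).

(** Squared bias plus binomial variance. The induction runs over all [b], since a success in one
    trial replaces [b] by [b - 1]. *)
Lemma bernstein_second_moment n (a b c : R) :
  (bernstein L n (fun k => a * (k%:R - b) ^+ 2 + c)).[t] =
  a * ((n%:R * L.[t] - b) ^+ 2 + n%:R * (L.[t] * (1 - L.[t]))) + c.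
Proof.
elim: n b => [|n IH] b /=; first by rewrite hornerC; ring.
have -> : (fun k => a * (k%:R - b) ^+ 2 + c) \o succn =
    fun k => a * (k%:R - (b - 1)) ^+ 2 + c.
  by apply/funext => k /=; rewrite -natr1; ring.
by rewrite !hornerE/= !IH -natr1; ring.
Qed.

Lemma bernsteinB n (g h : nat -> R) :
  (bernstein L n (fun k => g k - h k)).[t] =
  (bernstein L n g).[t] - (bernstein L n h).[t].
Proof.
elim: n g h => [|n IH] g h /=; first by rewrite !hornerC.
have -> : (fun k => g k - h k) \o succn =
    fun k => (g \o succn) k - (h \o succn) k by [].
by rewrite !hornerE/= !IH; ring.
Qed.

(** Each recursion step is a convex combination with weights [L.[t]] and [1 - L.[t]]. *)
Lemma ler_bernstein n (g h : nat -> R) : 0 <= L.[t] <= 1 ->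
  (forall k, (k <= n)%N -> g k <= h k) ->
  (bernstein L n g).[t] <= (bernstein L n h).[t].
Proof.
move=> /andP[L0 L1]; elim: n g h => [|n IH] g h gh /=.
  by rewrite !hornerC gh.
rewrite !hornerE lerD// ler_wpM2l// ?subr_ge0//; apply: IH => k kn /=.
  exact: gh.
by apply: gh; exact: leqW.
Qed.

End Bernstein.

(** Bernstein's argument: [f t - p.[t]] is the mean of [f t - f (x k)], which the quadratic modulus
    bounds pointwise; the mean of that bound is at most [D / n%:R + e / 2]. *)
Lemma weierstrass_approximation (R : realType) (a b : R) (f : R -> R) (e : R) :
  a < b -> {within `[a, b], continuous f} -> 0 < e ->
  exists p : {poly R}, forall t, t \in `[a, b] -> `|f t - p.[t]| <= e.
Proof.
move=> ab fc e0; have ba0 : 0 < b - a by rewrite subr_gt0.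
have [|C C0 fC] := segment_quadratic_modulus _ _ _ f (e / 2) (ltW ab) fc.
  by rewrite divr_gt0.
pose D := C * (b - a) ^+ 2.
have D0 : 0 <= D by rewrite mulr_ge0// sqr_ge0.
have [n n0 nD] : exists2 n, 0 < n%:R :> R & D / n%:R <= e / 2.
  exists (Num.truncn (D / (e / 2))).+1; first by rewrite ltr0n.
  rewrite ler_pdivrMr ?ltr0n// mulrC -ler_pdivrMr ?divr_gt0//.
  by apply/ltW/truncnS_gt.
pose L : {poly R} := (b - a)^-1 *: ('X - a%:P).
pose x (k : nat) := a + k%:R / n%:R * (b - a).
exists (bernstein L n (fun k => f (x k))) => t tab.
have Lt : L.[t] = (t - a) / (b - a) by rewrite !hornerE mulrC.
have L01 : 0 <= L.[t] <= 1.
  move: tab; rewrite Lt in_itv/= => /andP[ta tb].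
  by rewrite divr_ge0 ?subr_ge0//= ?(ltW ab)// ler_pdivrMr// mul1r lerD2r.
have xab k : (k <= n)%N -> x k \in `[a, b].
  move=> kn; rewrite in_itv/= lerDl mulr_ge0 ?divr_ge0 ?(ltW ba0)//=.
  suff : k%:R / n%:R * (b - a) <= b - a by rewrite /x; lra.
  by rewrite ler_piMl ?(ltW ba0)// ler_pdivrMr// mul1r ler_nat.
have bound k : (k <= n)%N -> `|f t - f (x k)| <=
    D / n%:R ^+ 2 * (k%:R - n%:R * L.[t]) ^+ 2 + e / 2.
  move=> kn; apply: (le_trans (fC _ _ tab (xab _ kn))).
  rewrite addrC lerD2r /D /x Lt le_eqVlt; apply/orP; left; apply/eqP.
  by field; rewrite gt_eqF//= gt_eqF.
(* Constants are the second-moment formula with quadratic coefficient 0. *)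
have cst c : (bernstein L n (fun=> c)).[t] = c.
  rewrite -[RHS]add0r -(mul0r ((n%:R * L.[t] - 0) ^+ 2 + n%:R * (L.[t] * (1 - L.[t])))).
  rewrite -bernstein_second_moment; congr (bernstein L n _).[t].
  by apply/funext => k; rewrite mul0r add0r.
rewrite -{1}(cst (f t)) -bernsteinB.
(* Centred at the mean [n%:R * L.[t]], the bias vanishes and only the variance is left. *)
have up : D / n%:R ^+ 2 * ((n%:R * L.[t] - n%:R * L.[t]) ^+ 2 +
    n%:R * (L.[t] * (1 - L.[t]))) + e / 2 <= e.
  rewrite subrr expr0n/= add0r.
  have -> : D / n%:R ^+ 2 * (n%:R * (L.[t] * (1 - L.[t]))) =
      D / n%:R * (L.[t] * (1 - L.[t])) by field; rewrite gt_eqF.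
  suff : D / n%:R * (L.[t] * (1 - L.[t])) <= e / 2 by lra.
  apply: le_trans nD; rewrite ler_piMr// ?divr_ge0// ?ltW//.
  by move/andP: L01 => [? ?]; nra.
rewrite ler_norml; apply/andP; split.
  rewrite lerNl; apply: le_trans up; rewrite -bernstein_second_moment.
  rewrite -[leLHS]add0r -{1}(cst 0) -bernsteinB.
  apply: ler_bernstein => // k /bound; rewrite ler_norml => /andP[].
  by rewrite sub0r lerNl.
apply: le_trans up; rewrite -bernstein_second_moment.
by apply: ler_bernstein => // k /bound; rewrite ler_norml => /andP[].
Qed.

(** * Derivatives and chords on a segment *)

Section SegmentDerivative.
Variables (R : realType) (a b : R).

(** Near an interior point the restriction to the segment is vacuous, so both notions of derivative
    agree after the change of variable [y = h + x]. *)
Lemma is_derive_in (f : R -> R) (x : R) : x \in `]a, b[ ->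
  derivable_in `[a, b] f -> is_derive x 1 f (derive_in `[a, b] f x).
Proof.
move=> xab df.
have xin : [set` `[a, b]] x by move: xab; rewrite /= !in_itv/= => /andP[? ?]; rewrite !ltW.
have dfx : (f y - f x) / (y - x) @[y --> within `[a, b] x^'] -->
    derive_in `[a, b] f x := df x xin.
have H : h^-1 *: ((f \o shift x) (h *: 1) - f x) @[h --> 0^'] -->
    derive_in `[a, b] f x.
  apply/cvgrPdist_lt => e e0; have /cvgrPdist_lt/(_ e e0) := dfx.
  rewrite near_withinE => dfe.
  have {}dfe : \forall y \near x^', `|derive_in `[a, b] f x - (f y - f x) / (y - x)| < e.
    have := near_in_itvoo xab => /nbhs_dnbhs xnear.
    near=> y; apply: (near dfe y) => //=.
    have : y \in `]a, b[ by near: y.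
    by rewrite !in_itv/= => /andP[? ?]; rewrite !ltW.
  move: dfe; rewrite near_withinE => /nbhs_ballP[r /= r0 xr].
  rewrite near_withinE; apply/nbhs_ballP; exists r => //= h; rewrite -ball_normE/= sub0r normrN.
  move=> hr h0; have := xr (h + x); rewrite -ball_normE/= opprD addrC subrK normrN => /(_ hr).
  rewrite -subr_eq0 addrK => /(_ h0); rewrite mulrC /shift/=.
  by rewrite /GRing.scale/= mulr1.
by apply: DeriveDef; [exact: cvgP H|exact: cvg_lim H].
Unshelve. all: by end_near. Qed.

(** The function [h = f + q] has second derivative [f'' - alpha >= 0] inside the segment, and [q]
    vanishes at both end points; so [h] is convex and lies below the chord of [f]. *)
Lemma le_chord (f : R -> R) (alpha t : R) : a < b ->
  {within `[a, b], continuous f} -> twice_derivable_in `[a, b] f ->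
  (forall s, s \in `[a, b] -> alpha <= derive_in `[a, b] (derive_in `[a, b] f) s) ->
  t \in `[a, b] ->
  f t <= (b - t) / (b - a) * f a + (t - a) / (b - a) * f b
         - alpha / 2 * ((b - t) * (t - a)).
Proof.
move=> ab fc [df ddf] ha tab.
pose q s := alpha / 2 * ((b - s) * (s - a)).
pose h : R -> R := f \+ q.
have dq (s : R) : is_derive s (1 : R) q (alpha / 2 * (b + a - 2 * s)).
  have -> : q = (alpha / 2) \*: ((cst b - id) * (id - cst a)).
    by apply/funext => u.
  by apply: is_derive_eq; rewrite /GRing.scale/= !fctE; ring.
have dh (s : R) : s \in `]a, b[ ->
    is_derive s 1 h (derive_in `[a, b] f s + alpha / 2 * (b + a - 2 * s)).
  by move=> sab; have := is_derive_in f _ sab df => dfs; apply: is_deriveD.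
have ddh (s : R) : s \in `]a, b[ -> is_derive s 1 ('D_1 h)
    (derive_in `[a, b] (derive_in `[a, b] f) s - alpha).
  move=> sab.
  (* The formula for ['D_1 h] is known on the open interval only, hence an equality near [s] rather
     than everywhere. *)
  apply: (@near_eq_is_derive _ _ _
      (derive_in `[a, b] f + (alpha / 2) \*: (cst (b + a) - 2 \*: id))).
    have := near_in_itvoo sab; apply: filterS => u uab /=.
    by have := dh _ uab => dhu; rewrite derive_val.
  have := is_derive_in _ _ sab ddf => dfs.
  by apply: is_derive_eq; rewrite /GRing.scale/=; field.
have [_ fa fb] := (continuous_within_itvP f ab).1 fc.
have qc : continuous q.
  by move=> s; apply/differentiable_continuous/derivable1_diffP; have [] := dq s.
have ba0 : 0 < b - a by rewrite subr_gt0.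
have [t0 t1] : 0 <= (b - t) / (b - a) /\ (b - t) / (b - a) <= 1.
  move: tab; rewrite in_itv/= => /andP[ta tb].
  by rewrite divr_ge0 ?subr_ge0 ?(ltW ab)// ler_pdivrMr// mul1r lerD2l lerN2.
have : h (conv (Itv01 t0 t1) (a : R^o) (b : R^o)) <=
    conv (Itv01 t0 t1) (h a : R^o) (h b : R^o).
  apply: second_derivative_convex; last exact: ltW.
  - move=> s sab; have sab' : s \in `]a, b[ by rewrite in_itv.
    have := ddh _ sab' => ddhs; rewrite derive_val subr_ge0 ha// in_itv/=.
    by move/andP: sab => [? ?]; rewrite !ltW.
  - by apply: cvgD fb _; apply: cvg_at_left_filter; exact: qc.
  - by apply: cvgD fa _; apply: cvg_at_right_filter; exact: qc.
  - by move=> s /dh[].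
  - by move=> s /ddh[].
rewrite !convRE/= /unstable.onem.
have -> : (b - t) / (b - a) * a + (1 - (b - t) / (b - a)) * b = t.
  by field; rewrite gt_eqF.
have -> : 1 - (b - t) / (b - a) = (t - a) / (b - a) by field; rewrite gt_eqF.
by rewrite /h/= /q !subrr !(mul0r, mulr0) !addr0 -lerBrDr.
Qed.

End SegmentDerivative.

(** * The ratio of the chord to the function *)

Section Kmax.
Variables (R : realType) (m M : R) (f : R -> R).
Hypotheses (mM : m < M) (fc : {within `[m, M], continuous f}).
Hypothesis f0 : forall t, t \in `[m, M] -> 0 < f t.

Lemma le_Kmax t : t \in `[m, M] ->
  (M - t) / (M - m) * f m + (t - m) / (M - m) * f M <= Kmax m M f * f t.
Proof.
move=> tmM; rewrite -ler_pdivrMr ?f0// mulrC.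
have ba0 : 0 < M - m by rewrite subr_gt0.
apply: ub_le_sup; last by exists t.
have [c cmM fmin] := EVT_min (ltW mM) fc.
(* The supremum is an upper bound once the set is bounded: [f] is at least its minimum [f c], and
   both chord weights are at most 1. *)
exists ((f c)^-1 * (f m + f M)) => _ [s /= smM <-].
have fm : 0 < f m by rewrite f0// in_itv/= lexx ltW.
have fM : 0 < f M by rewrite f0// in_itv/= lexx ltW.
move: (smM); rewrite in_itv/= => /andP[ms sM].
apply: ler_pM; first by rewrite invr_ge0 ltW ?f0.
- by rewrite addr_ge0// mulr_ge0 ?divr_ge0 ?subr_ge0// ltW.
- by rewrite lef_pV2 ?posrE ?f0// fmin.
- by apply: lerD; rewrite ler_piMl ?(ltW fm) ?(ltW fM)// ler_pdivrMr// mul1r; lra.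
Qed.

(** At [t = m] the chord equals [f m], so [f m <= Kmax m M f * f m]. *)
Lemma Kmax_gt0 : 0 < Kmax m M f.
Proof.
have mmM : m \in `[m, M] by rewrite in_itv/= lexx ltW.
have := le_Kmax _ mmM; rewrite subrr mul0r mul0r addr0 divff ?mul1r; last first.
  by rewrite subr_eq0 gt_eqF.
by move=> h; have := lt_le_trans (f0 _ mmM) h; rewrite pmulr_lgt0 ?f0.
Qed.

End Kmax.

(** * Inner products and positive operators *)

Section Inner.
Context {R : realType} {H : hilbertType R}.
Implicit Types (x y z : H) (a : R[i]).

Lemma innerDl x y z : inner (x + y) z = inner x z + inner y z.
Proof. by rewrite -[x in LHS]scale1r inner_linearl mul1r. Qed.

Lemma inner0l z : inner 0 z = 0.
Proof. by apply: (@addIr _ (inner 0 z)); rewrite -innerDl !add0r. Qed.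

Lemma innerZl a x z : inner (a *: x) z = a * inner x z.
Proof. by rewrite -[a *: x]addr0 inner_linearl inner0l addr0. Qed.

Lemma innerNl x z : inner (- x) z = - inner x z.
Proof. by rewrite -scaleN1r innerZl mulN1r. Qed.

Lemma innerBl x y z : inner (x - y) z = inner x z - inner y z.
Proof. by rewrite innerDl innerNl. Qed.

Lemma innerDr x y z : inner z (x + y) = inner z x + inner z y.
Proof. by rewrite inner_conj innerDl rmorphD/= -!inner_conj. Qed.

Lemma innerZr a x z : inner z (a *: x) = Num.conj a * inner z x.
Proof. by rewrite inner_conj innerZl rmorphM/= -inner_conj. Qed.

Lemma innerNr x z : inner z (- x) = - inner z x.
Proof. by rewrite inner_conj innerNl rmorphN/= -inner_conj. Qed.

Lemma innerBr x y z : inner z (x - y) = inner z x - inner z y.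
Proof. by rewrite innerDr innerNr. Qed.

Lemma complexR_ge0 (z : R[i]) : 0 <= z -> (complex.Re z)%:C = z.
Proof. by move=> /ger0_real/RRe_real. Qed.

Lemma ge0_complexE (z : R[i]) : 0 <= z -> exists2 r : R, 0 <= r & z = r%:C.
Proof.
by move=> z0; exists (complex.Re z); [rewrite -ler0c|]; rewrite complexR_ge0.
Qed.

End Inner.

Section Operators.
Context {R : realType} {H : hilbertType R}.
Implicit Types (A B P : 'B(H)) (x y : H) (a : R[i]) (c : R).

Lemma opD A B x : (A + B) x = A x + B x. Proof. by []. Qed.
Lemma opN A x : (- A) x = - A x. Proof. by []. Qed.
Lemma opB A B x : (A - B) x = A x - B x. Proof. by []. Qed.
Lemma opZ a A x : (a *: A) x = a *: A x. Proof. by []. Qed.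
Lemma opM A B x : (A * B) x = A (B x). Proof. by []. Qed.
Lemma op_one x : (1 : 'B(H)) x = x. Proof. by []. Qed.
Lemma op0 x : (0 : 'B(H)) x = 0. Proof. by []. Qed.
Lemma opP A B : (forall x, A x = B x) -> A = B.
Proof. by move=> AB; apply/val_inj/funext. Qed.

Lemma op_linear A : linear A.
Proof. by have [] := bounded_operatorP _ (valP A). Qed.

Lemma op_addr A x y : A (x + y) = A x + A y.
Proof. by have := op_linear A 1 x y; rewrite !scale1r. Qed.

Lemma op_zero A : A 0 = 0.
Proof. by apply: (@addIr _ (A 0)); rewrite -op_addr !add0r. Qed.

Lemma op_scale A a x : A (a *: x) = a *: A x.
Proof. by have := op_linear A a x 0; rewrite op_zero !addr0. Qed.

Lemma op_opp A x : A (- x) = - A x.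
Proof. by rewrite -scaleN1r op_scale scaleN1r. Qed.

Lemma op_sub A x y : A (x - y) = A x - A y.
Proof. by rewrite op_addr op_opp. Qed.

(** Norm estimates go through this predicate, with a real constant, rather than through the supremum
    [opnorm]; [opnorm_le] and [opnorm_bound] link the two. *)
Definition bounded_by A c := forall x, `|A x| <= c%:C * `|x|.

Lemma bounded_op A : exists2 c : R, 0 <= c & bounded_by A c.
Proof.
have [_ [c hc]] := bounded_operatorP _ (valP A).
exists (complex.Re `|c|); first by rewrite -ler0c complexR_ge0.
move=> x; rewrite complexR_ge0//.
rewrite -[`|x| in leRHS]normr_id -normrM; apply: le_trans (hc x) _.
by rewrite real_ler_norm// ger0_real// (le_trans _ (hc x)).
Qed.

Lemma selfadjointB A B : selfadjoint A -> selfadjoint B -> selfadjoint (A - B).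
Proof. by move=> hA hB x y; rewrite !opB innerBl innerBr hA hB. Qed.

Lemma selfadjointD A B : selfadjoint A -> selfadjoint B -> selfadjoint (A + B).
Proof. by move=> hA hB x y; rewrite !opD innerDl innerDr hA hB. Qed.

Lemma selfadjointN A : selfadjoint A -> selfadjoint (- A).
Proof. by move=> hA x y; rewrite !opN innerNl innerNr hA. Qed.

Lemma selfadjoint_scalar c : selfadjoint (scalar_op c%:C : 'B(H)).
Proof.
by move=> x y; rewrite !opZ innerZl innerZr; congr (_ * _); rewrite /Num.conj/= oppr0.
Qed.

Lemma selfadjointZ c A : selfadjoint A -> selfadjoint (c%:C *: A).
Proof.
move=> hA x y; rewrite !opZ innerZl innerZr hA; congr (_ * _).
by rewrite /Num.conj/= oppr0.
Qed.

Lemma selfadjointX A n : selfadjoint A -> selfadjoint (A ^+ n).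
Proof.
move=> hA; elim: n => [|n IH] x y; first by rewrite expr0.
by rewrite [in LHS]exprS [in RHS]exprSr !opM hA IH.
Qed.

Lemma selfadjoint_real A x : selfadjoint A ->
  inner (A x) x = (complex.Re (inner (A x) x))%:C.
Proof.
move=> hA; rewrite RRe_real//; apply/CrealP.
by rewrite -inner_conj hA.
Qed.

(* Over the complex scalars positivity forces self-adjointness, by
   polarization. *)
Lemma positive_selfadjoint P : positive_op P -> selfadjoint P.
Proof.
move=> hP x y; rewrite [RHS]inner_conj.
(* Vanishing imaginary parts at [x + y] and at [x + 'i%C *: y] match the imaginary and the real
   parts of the two mixed terms, respectively. *)
have h1 := hP (x + y); have h2 := hP (x + 'i%C *: y).
have hx := hP x; have hy := hP y.
move: h1 h2 hx hy; rewrite !op_addr !op_scale !innerDl !innerDr !innerZl !innerZr.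
move: (inner (P x) x) (inner (P y) y) (inner (P x) y) (inner (P y) x).
move=> [a b] [c d] [p q] [r s]; rewrite !lecE/= => /andP[/eqP h1 _] /andP[/eqP h2 _].
move=> /andP[/eqP hx _] /andP[/eqP hy _]; apply/eqP; rewrite eq_complex /=.
by apply/andP; split; apply/eqP; move: h1 h2 hx hy; lra.
Qed.

Lemma positiveD P A : positive_op P -> positive_op A -> positive_op (P + A).
Proof. by move=> hP hA x; rewrite opD innerDl addr_ge0. Qed.

Lemma positiveZ c P : 0 <= c -> positive_op P -> positive_op (c%:C *: P).
Proof. by move=> c0 hP x; rewrite opZ innerZl mulr_ge0// ler0c. Qed.

Lemma positive_scalar c : 0 <= c -> positive_op (scalar_op c%:C : 'B(H)).
Proof. by move=> c0 x; rewrite opZ innerZl innerxx mulr_ge0 ?exprn_ge0// ler0c. Qed.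

Lemma positive_sqr A : selfadjoint A -> positive_op (A * A).
Proof. by move=> hA x; rewrite opM hA innerxx exprn_ge0. Qed.

(** Evaluate at the minimizer [t = c^-1]. If [c = 0] the expression is affine in [t], and a positive
    [b] would make it negative at [(a + 1) / b]. *)
Lemma real_discriminant (a b c : R) : 0 <= a -> 0 <= b -> 0 <= c ->
  (forall t, 0 <= t -> 0 <= a - 2 * t * b + t ^+ 2 * b * c) -> b <= a * c.
Proof.
move=> a0 b0 c0 h; have [c00|cn0] := eqVneq c 0.
  rewrite c00 {c0 c00} in h *; rewrite mulr0 leNgt; apply/negP => bp.
  have := h ((a + 1) / b) (divr_ge0 (addr_ge0 a0 ler01) b0).
  have -> : a - 2 * ((a + 1) / b) * b + ((a + 1) / b) ^+ 2 * b * 0 = - a - 2.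
    by field; rewrite gt_eqF.
  by lra.
have cp : 0 < c by rewrite lt0r cn0.
have : 0 <= c^-1 by rewrite invr_ge0.
move=> /h.
have -> : a - 2 * c^-1 * b + c^-1 ^+ 2 * b * c = a - b / c by field.
by rewrite subr_ge0 ler_pdivrMr.
Qed.

(** Positivity at [x - (t%:C * b) *: y], with [b = inner (P x) y] absorbing the phase, gives a real
    quadratic in [t]. *)
Lemma positive_cauchy_schwarz P x y : positive_op P ->
  `|inner (P x) y| ^+ 2 <= inner (P x) x * inner (P y) y.
Proof.
move=> hP; have hPs := positive_selfadjoint _ hP.
set b := inner (P x) y.
have N0 : 0 <= `|b| ^+ 2 by rewrite exprn_ge0.
have [p p0 Ep] := ge0_complexE _ (hP x).
have [q q0 Eq] := ge0_complexE _ (hP y).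
have [N N1 EN] := ge0_complexE _ N0.
rewrite Ep Eq EN -(rmorphM (real_complex R)) lecR.
apply: real_discriminant => // t t0.
have := hP (x - (t%:C * b) *: y).
rewrite op_sub op_scale innerBl !innerBr !innerZl !innerZr.
have -> : inner (P y) x = Num.conj b by rewrite -inner_conj hPs.
rewrite -/b rmorphM/= Ep Eq.
have -> : Num.conj t%:C = t%:C :> R[i] by rewrite /Num.conj/= oppr0.
move: EN; rewrite normCK => EN.
have -> : p%:C - t%:C * Num.conj b * b -
  (t%:C * b * Num.conj b - t%:C * b * (t%:C * Num.conj b * q%:C)) =
  p%:C - 2 * t%:C * (b * Num.conj b) + t%:C ^+ 2 * (b * Num.conj b) * q%:C.
  by ring.
rewrite EN -(rmorphXn (real_complex R)) -(rmorph_nat (real_complex R) 2).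
by rewrite -!(rmorphM (real_complex R)) -rmorphB -rmorphD ler0c.
Qed.

Lemma cauchy_schwarz x y : `|inner x y| <= `|x| * `|y|.
Proof.
rewrite -(ler_pXn2r (n:=2))// ?nnegrE ?mulr_ge0//.
rewrite exprMn -!innerxx.
have p1 : positive_op (1 : 'B(H)) by move=> z; rewrite op_one innerxx exprn_ge0.
exact: (positive_cauchy_schwarz _ x y p1).
Qed.

Lemma bounded_positive_sub A c : selfadjoint A -> bounded_by A c ->
  positive_op (scalar_op c%:C - A).
Proof.
move=> hA hc x; rewrite opB opZ innerBl innerZl op_one innerxx subr_ge0.
have h : `|inner (A x) x| <= c%:C * `|x| ^+ 2.
  by apply: le_trans (cauchy_schwarz _ _) _; rewrite expr2 mulrA ler_wpM2r.
apply: le_trans h; rewrite real_ler_norm// selfadjoint_real//.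
by apply/complex_realP; eexists.
Qed.

(** Cauchy-Schwarz for [P] at [x] and [P x] bounds the fourth power of the norm of [P x] by [inner
    (P x) x * (c%:C * inner (P x) (P x))]; one squared norm then cancels. *)
Lemma positive_sqnorm_le P c x : positive_op P ->
  positive_op (scalar_op c%:C - P) -> `|P x| ^+ 2 <= c%:C * inner (P x) x.
Proof.
move=> hP hcP; have := positive_cauchy_schwarz _ x (P x) hP.
rewrite innerxx ger0_norm ?exprn_ge0// => h.
have := hcP (P x); rewrite opB opZ innerBl innerZl op_one innerxx subr_ge0 => h'.
have {}h := le_trans h (ler_wpM2l (hP x) h').
have [p0|p0] := eqVneq (`|P x| ^+ 2) 0.
  rewrite p0 in h' h *; have /eqP : `|P x| = 0 by apply/eqP; rewrite -sqrf_eq0 p0.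
  by rewrite normr_eq0 => /eqP ->; rewrite inner0l mulr0.
have pp : 0 < `|P x| ^+ 2 by rewrite lt0r p0 exprn_ge0.
by rewrite -(ler_pM2r pp) -expr2; apply: le_trans h _; rewrite mulrCA mulrA.
Qed.

End Operators.

(** * Completeness and the Neumann series *)

Section Completeness.
Context {R : realType} {H : hilbertType R}.
Implicit Types (A B P : 'B(H)) (x y : H) (a : R[i]) (c : R).

(** The order of [R[i]] forces equal imaginary parts, which the single instance [d = 1] already
    provides. *)
Lemma complex_ler_addgt0 (z w : R[i]) :
  (forall d : R, 0 < d -> z <= w + d%:C) -> z <= w.
Proof.
case: z w => [a b] [c d] h.
have := h 1 ltr01; rewrite lecE/= addr0 => /andP[Im _]; rewrite lecE/= Im/=.
apply/ler_addgt0Pr => e e0; have := h e e0; rewrite lecE/= => /andP[_ //].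
Qed.

Lemma bounded_byD A B c d : bounded_by A c -> bounded_by B d ->
  bounded_by (A + B) (c + d).
Proof.
move=> hA hB x; rewrite opD rmorphD/= mulrDl.
by apply: le_trans (ler_normD _ _) _; apply: lerD.
Qed.

Lemma bounded_byN A c : bounded_by A c -> bounded_by (- A) c.
Proof. by move=> hA x; rewrite opN normrN. Qed.

Lemma bounded_byM A B c d : 0 <= c -> bounded_by A c -> bounded_by B d ->
  bounded_by (A * B) (c * d).
Proof.
move=> c0 hA hB x; rewrite opM rmorphM/= -mulrA.
by apply: le_trans (hA _) _; rewrite ler_wpM2l// ler0c.
Qed.

Lemma bounded_by_le A c d : c <= d -> bounded_by A c -> bounded_by A d.
Proof. by move=> cd hA x; apply: le_trans (hA x) _; rewrite ler_wpM2r// lecR. Qed.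

Lemma bounded_by_eq0 A : (forall d, 0 < d -> bounded_by A d) -> A = 0.
Proof.
move=> h; apply: opP => x; rewrite op0; apply/eqP; rewrite -normr_eq0.
rewrite eq_le normr_ge0 andbT; apply: complex_ler_addgt0 => d d0; rewrite add0r.
have [s s0 Es] := ge0_complexE _ (normr_ge0 x).
have s1 : 0 < s + 1 by rewrite ltr_wpDl.
apply: le_trans (h (d / (s + 1)) _ x) _; first by rewrite divr_gt0.
rewrite Es -(rmorphM (real_complex R)) lecR mulrAC ler_pdivrMr// ler_wpM2l ?ltW//.
by rewrite ltrDl.
Qed.

(** The limit is taken pointwise, by completeness of [H]; linearity and the bounds [e n] pass to the
    limit, and the bound at [n = 0] makes it a bounded operator. *)
Lemma op_complete (T : nat -> 'B(H)) (e : nat -> R) :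
  e @ \oo --> 0 -> (forall n k, (n <= k)%N -> bounded_by (T n - T k) (e n)) ->
  exists B, forall n, bounded_by (T n - B) (e n).
Proof.
move=> e0 hT.
have small x (d : R) : 0 < d -> exists N, forall k, (N <= k)%N ->
    (e k)%:C * `|x| < d%:C.
  move=> d0; have [s s0 ->] := ge0_complexE _ (normr_ge0 x).
  have s1 : 0 < s + 1 by rewrite ltr_wpDl.
  have ds : 0 < d / (s + 1) by rewrite divr_gt0.
  have /cvgrPdist_lt/(_ _ ds)[N _ hN] := e0.
  exists N => k /hN/=; rewrite sub0r normrN => ek.
  rewrite -(rmorphM (real_complex R)) ltcR.
  have : `|e k| * (s + 1) < d by rewrite -ltr_pdivlMr.
  apply: le_lt_trans; apply: le_trans (ler_wpM2r s0 (ler_norm _)) _.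
  by rewrite ler_wpM2l// lerDl.
have cv x : cvgn (fun n => T n x).
  apply/cauchy_cvgP/cauchy_exP => eps eps0.
  have [d d0 Ed] := ge0_complexE _ (ltW eps0).
  have d1 : 0 < d by rewrite -ltcR -Ed.
  have [N hN] := small x d d1.
  exists (T N x); exists N => // k /= Nk; rewrite -ball_normE/= Ed.
  by rewrite -opB; apply: le_lt_trans (hT _ _ Nk x) (hN _ _).
pose B x := limn (fun n => T n x).
have TB x : (fun n => T n x) @ \oo --> B x by exact: cv.
have bnd n x : `|T n x - B x| <= (e n)%:C * `|x|.
  apply: complex_ler_addgt0 => d d0.
  have /cvgrPdist_lt/(_ d%:C)[|N _ hN] := TB x; first by rewrite ltcR.
  have := hN (maxn N n) (leq_maxl _ _) => /= h1.
  have := hT n (maxn N n) (leq_maxr _ _) x; rewrite opB => h2.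
  apply: le_trans (ler_distD (T (maxn N n) x) _ _) _.
  by apply: lerD => //; rewrite distrC ltW.
have linB : linear B.
  move=> a x y; apply: cvg_lim; first exact: norm_hausdorff.
  have -> : (fun n => T n (a *: x + y)) = (fun n => a *: T n x + T n y).
    by apply/funext => n; exact: op_linear.
  by apply: cvgD => //; apply: cvgZr; exact: TB.
have hB : B \in bounded_operator.
  apply/bounded_operatorP; split=> //.
  have [c c0 hc] := bounded_op (T 0).
  exists (c%:C + (e 0%N)%:C) => x; rewrite mulrDl.
  have -> : B x = T 0 x - (T 0 x - B x) by rewrite opprB addrC subrK.
  by apply: le_trans (ler_normB _ _) _; apply: lerD.
by exists (Operator hB) => n x; rewrite opB; exact: bnd.
Qed.

Lemma bounded_byX A k n : 0 <= k -> bounded_by A k -> bounded_by (A ^+ n) (k ^+ n).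
Proof.
move=> k0 hA; elim: n => [|n IH]; first by move=> x; rewrite !expr0 op_one mul1r.
by rewrite !exprS; apply: bounded_byM.
Qed.

Lemma bounded_by_geometric A k n : 0 <= k -> k < 1 -> bounded_by A k ->
  bounded_by (\sum_(i < n) A ^+ i) (1 - k)^-1.
Proof.
move=> k0 k1 hA; have k1' : 0 < 1 - k by rewrite subr_gt0.
have h : bounded_by (\sum_(i < n) A ^+ i) (\sum_(i < n) k ^+ i).
  elim: n => [|n IH]; first by move=> x; rewrite !big_ord0 op0 normr0 mul0r.
  by rewrite !big_ord_recr/=; apply: bounded_byD => //; apply: bounded_byX.
apply: bounded_by_le h; rewrite -[leRHS]mul1r ler_pdivlMr//.
have := subrX1 k n; rewrite -[X in _ = X * _]opprB mulNr => /(congr1 -%R).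
by rewrite opprK opprB mulrC => <-; rewrite gerBl exprn_ge0.
Qed.

(** The inverse is the limit of the partial sums [T n] of the geometric series; both products of
    [T n] with [1 - A] equal [1 - A ^+ n]. *)
Lemma neumann_invertible A k : 0 <= k -> k < 1 -> bounded_by A k ->
  exists B, B * (1 - A) = 1 /\ (1 - A) * B = 1.
Proof.
move=> k0 k1 hA; have k1' : 0 < 1 - k by rewrite subr_gt0.
pose T n := \sum_(i < n) A ^+ i.
have kn0 : (fun n => k ^+ n * (1 - k)^-1) @ \oo --> 0.
  rewrite -[X in _ --> X](mul0r (1 - k)^-1); apply: cvgMl.
  by apply: cvg_expr; rewrite ger0_norm.
have T1 n : (1 - A) * T n = 1 - A ^+ n by rewrite -opprB mulNr -subrX1 opprB.
have T2 n : T n * (1 - A) = 1 - A ^+ n.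
  rewrite -T1; apply: commr_sym; apply: commr_sum => i _; apply: commrX.
  by apply: commr_sym; apply: commrB; [exact: commr1|exact: commr_refl].
have [n k' nk|B hB] := op_complete T _ kn0.
  rewrite -opprB; apply: bounded_byN.
  (* Factoring [A ^+ n] out of the tail gives the Cauchy bound [k ^+ n * (1 - k)^-1]. *)
  have -> : T k' - T n = A ^+ n * T (k' - n)%N.
    rewrite /T -!(big_mkord xpredT) (big_cat_nat _ nk)//= addrAC subrr add0r.
    rewrite big_distrr/= -{1}(add0n n) big_addn; apply: eq_bigr => i _.
    by rewrite -exprD addnC.
  apply: bounded_byM; [by rewrite exprn_ge0|exact: bounded_byX|].
  exact: bounded_by_geometric.
have [c c0 hc] := bounded_op (1 - A).
have lim0 d : 0 < d -> exists n, c * (k ^+ n * (1 - k)^-1) + k ^+ n <= d.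
  move=> d0.
  have h : (fun n => c * (k ^+ n * (1 - k)^-1) + k ^+ n) @ \oo --> 0.
    rewrite -[X in _ --> X](addr0 0) -[X in _ --> X + _](mulr0 c).
    by apply: cvgD; [exact: cvgMr|apply: cvg_expr; rewrite ger0_norm].
  have /cvgrPdist_lt/(_ _ d0)[N _ hN] := h.
  exists N; have := hN N (leqnn _); rewrite /= sub0r normrN => /ltW.
  exact: le_trans (ler_norm _).
exists B; split; apply/eqP; rewrite -subr_eq0; apply/eqP; apply: bounded_by_eq0 => d d0.
- have [n hn] := lim0 d d0; apply: (bounded_by_le _ _ _ hn).
  have -> : B * (1 - A) - 1 = - ((T n - B) * (1 - A) + A ^+ n).
    by rewrite mulrBl T2 opprD opprB -addrA -opprD subrK.
  apply: bounded_byN; apply: bounded_byD; last exact: bounded_byX.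
  rewrite mulrC; apply: bounded_byM => //.
  by rewrite mulr_ge0 ?exprn_ge0// invr_ge0 ltW.
- have [n hn] := lim0 d d0; apply: (bounded_by_le _ _ _ hn).
  have -> : (1 - A) * B - 1 = - ((1 - A) * (T n - B) + A ^+ n).
    by rewrite mulrBr T1 opprD opprB -addrA -opprD subrK.
  apply: bounded_byN; apply: bounded_byD; last exact: bounded_byX.
  exact: bounded_byM.
Qed.

Lemma scalar_opB a b : scalar_op (a - b) = scalar_op a - scalar_op b :> 'B(H).
Proof. exact: scalerBl. Qed.

Lemma scalar_opD a b : scalar_op (a + b) = scalar_op a + scalar_op b :> 'B(H).
Proof. exact: scalerDl. Qed.

Lemma scalar_op1 : scalar_op 1 = 1 :> 'B(H).
Proof. exact: scale1r. Qed.

Lemma mul_scalar_op a A : scalar_op a * A = a *: A.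
Proof. by apply: opP => x; rewrite opM !opZ. Qed.

Lemma mul_op_scalar a A : A * scalar_op a = a *: A.
Proof. by apply: opP => x; rewrite opM !opZ op_scale. Qed.

Lemma op_scalerAl a A B : a *: (A * B) = a *: A * B.
Proof. by rewrite -!mul_scalar_op mulrA. Qed.

Lemma op_scalerAr a A B : a *: (A * B) = A * (a *: B).
Proof. by rewrite -!mul_op_scalar mulrA. Qed.

(** With [c] a bound of [P], the operator [S = 1 - P / c] satisfies [0 <= S <= k = 1 - d / c], hence
    has norm at most [k < 1], and the Neumann series inverts [1 - S = P / c]. *)
Lemma positive_invertible P (d : R) : 0 < d -> positive_op (P - scalar_op d%:C) ->
  exists B, B * P = 1 /\ P * B = 1.
Proof.
move=> d0 hPd.
have hP : positive_op P.
  rewrite -[P](subrK (scalar_op d%:C)); apply: positiveD => //.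
  exact/positive_scalar/ltW.
have hPs := positive_selfadjoint _ hP.
have [c' c'0 hc'] := bounded_op P.
(* Adding [d] ensures [c > 0] and [d / c <= 1]. *)
pose c := c' + d; have c0 : 0 < c by rewrite ltr_wpDl.
have hc : bounded_by P c by apply: bounded_by_le hc'; rewrite lerDl ltW.
pose S := 1 - c^-1%:C *: P.
have cV (r : R) : c^-1%:C *: scalar_op r%:C = scalar_op (r / c)%:C :> 'B(H).
  by rewrite scalerA -(rmorphM (real_complex R)) mulrC.
have S0 : positive_op S.
  have -> : S = c^-1%:C *: (scalar_op c%:C - P).
    by rewrite scalerBr cV divff ?gt_eqF// scalar_op1.
  by apply: positiveZ; [rewrite invr_ge0 ltW|exact: bounded_positive_sub].
pose k := 1 - d / c.
have k0 : 0 <= k by rewrite subr_ge0 ler_pdivrMr// mul1r lerDr.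
have k1 : k < 1 by rewrite gtrBl divr_gt0.
have Sk : positive_op (scalar_op k%:C - S).
  have -> : scalar_op k%:C - S = c^-1%:C *: (P - scalar_op d%:C).
    rewrite scalerBr cV /k rmorphB/= scalar_opB scalar_op1 /S opprB.
    by rewrite addrC addrA subrK.
  by apply: positiveZ; rewrite // invr_ge0 ltW.
have hS : bounded_by S k.
  move=> x; rewrite -(ler_pXn2r (n:=2))// ?nnegrE ?mulr_ge0 ?ler0c//.
  apply: le_trans (positive_sqnorm_le _ _ _ S0 Sk) _.
  rewrite exprMn expr2 -mulrA ler_wpM2l ?ler0c//.
  have := Sk x; rewrite opB opZ innerBl innerZl op_one innerxx subr_ge0.
  by [].
have [B [B1 B2]] := neumann_invertible S k k0 k1 hS.
have SE : 1 - S = c^-1%:C *: P by rewrite /S opprB addrCA subrr addr0.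
exists (c^-1%:C *: B); rewrite -op_scalerAl -op_scalerAr.
by rewrite op_scalerAr op_scalerAl -SE.
Qed.

End Completeness.

(** * The spectrum of a self-adjoint operator *)

Section Spectrum.
Context {R : realType} {H : hilbertType R}.
Implicit Types (A B P : 'B(H)) (x y : H) (z : R[i]) (t : R).

Definition op_invertible A := exists B, B * A = 1 /\ A * B = 1.

Lemma not_spectrum A z : ~ spectrum A z -> op_invertible (A - scalar_op z).
Proof. by move/contrapT. Qed.

(** If [E] inverts [A * B], then [B * E] is a right inverse of [A] and [E * B] a left one, so they
    coincide. *)
Lemma op_invertible_factor A B : A * B = B * A -> op_invertible (A * B) ->
  op_invertible A.
Proof.
move=> AB [E [E1 E2]]; exists (B * E); split; last by rewrite mulrA.
have EB : E * B * A = 1 by rewrite -mulrA -AB.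
have -> : B * E = E * B by rewrite -[RHS]mulr1 -E2 -[A * B * E]mulrA 2!mulrA EB mul1r.
exact: EB.
Qed.

Lemma op_invertibleM A B : op_invertible A -> op_invertible B ->
  op_invertible (A * B).
Proof.
move=> [C [C1 C2]] [D [D1 D2]]; exists (D * C); split.
  by rewrite -mulrA (mulrA C) C1 mul1r.
by rewrite -mulrA (mulrA B) D2 mul1r.
Qed.

Lemma op_invertibleZ z A : z != 0 -> op_invertible A -> op_invertible (z *: A).
Proof.
move=> z0 [B [B1 B2]]; exists (z^-1 *: B).
by rewrite -!op_scalerAl -!op_scalerAr B1 B2 !scalerA mulVf// mulfV// !scale1r.
Qed.

Lemma op_invertibleN A : op_invertible A -> op_invertible (- A).
Proof. by move=> [B [B1 B2]]; exists (- B); rewrite !mulrNN. Qed.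

(** For [z = a + ib] with [b != 0], the commuting factors [A - z] and [A - conj z] have product
    [(A - a)^2 + b^2 >= b^2], which is invertible. *)
Lemma spectrum_real A z : selfadjoint A -> spectrum A z -> z = (complex.Re z)%:C.
Proof.
move=> hA hz; case: z hz => a b /=; have [->//|b0] := eqVneq b 0.
suff inv : op_invertible (A - scalar_op (a +i* b)) by move=> /(_ inv).
pose D := A - scalar_op a%:C; pose w : R[i] := 0 +i* b; pose W : 'B(H) := scalar_op w.
have DW : D * W = W * D by rewrite mul_scalar_op mul_op_scalar.
have -> : A - scalar_op (a +i* b) = D - W.
  rewrite -addrA -opprD -scalar_opD; congr (_ - scalar_op _).
  by apply/eqP; rewrite eq_complex /= addr0 add0r !eqxx.
have WW : - (W * W) = scalar_op (b ^+ 2)%:C.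
  rewrite mul_scalar_op /W /scalar_op scalerA -scaleNr; congr (_ *: _).
  by apply/eqP; rewrite eq_complex /= !(mul0r, mulr0, addr0, sub0r) opprK oppr0 expr2 !eqxx.
have [DWE DWE'] : (D - W) * (D + W) = D * D + scalar_op (b ^+ 2)%:C /\
    (D + W) * (D - W) = D * D + scalar_op (b ^+ 2)%:C.
  rewrite -WW; move: D W DW {WW} => X Y XY; rewrite mulrBl mulrBr !mulrDr !mulrDl.
  by rewrite XY !opprD !addrA !addrK.
apply: (@op_invertible_factor _ (D + W)).
  by rewrite DWE DWE'.
rewrite DWE; apply: (@positive_invertible _ _ _ (b ^+ 2)).
  by rewrite exprn_even_gt0.
rewrite addrK; apply: positive_sqr; apply: selfadjointB => //.
exact: selfadjoint_scalar.
Qed.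

Lemma spectrum_ge A (m t : R) : positive_op (A - scalar_op m%:C) ->
  spectrum A t%:C -> m <= t.
Proof.
move=> hA hS; rewrite leNgt; apply/negP => tm; apply: hS.
apply: (@positive_invertible _ _ _ (m - t)); first by rewrite subr_gt0.
by rewrite rmorphB/= scalar_opB opprB addrA subrK.
Qed.

Lemma spectrum_le A (M t : R) : positive_op (scalar_op M%:C - A) ->
  spectrum A t%:C -> t <= M.
Proof.
move=> hA hS; rewrite leNgt; apply/negP => tM; apply: hS.
rewrite -opprB; apply: op_invertibleN.
apply: (@positive_invertible _ _ _ (t - M)); first by rewrite subr_gt0.
rewrite rmorphB/= scalar_opB opprB addrC addrA subrK.
exact: hA.
Qed.

(* If [A] had a negative greatest lower bound [a], the positive operator [A - a]
   would be invertible, hence bounded below by a positive constant, and [a]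
   would not be the greatest lower bound. *)
Lemma spectrum_positive A : selfadjoint A ->
  (forall t, t < 0 -> ~ spectrum A t%:C) -> positive_op A.
Proof.
move=> hA hS; apply: contrapT => nA.
pose S := [set r : R | positive_op (A - scalar_op r%:C)].
have Sneg r : S r -> r < 0.
  move=> Sr; rewrite ltNge; apply/negP => r0; apply: nA.
  by rewrite -[A](subrK (scalar_op r%:C)); apply: positiveD Sr _; exact: positive_scalar.
have S0 : has_sup S.
  split; last by exists 0 => r /Sneg/ltW.
  have [c c0 hc] := bounded_op A; exists (- c).
  rewrite /S/= rmorphN/= -scaleN1r /scalar_op scalerA mulN1r opprK addrC.
  rewrite -[A]opprK; apply: bounded_positive_sub; last exact: bounded_byN.
  exact: selfadjointN.
pose a := sup S.
(* The supremum is attained, because [S] is closed: each quadratic form inequality survives the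
   limit. *)
have Sa : S a.
  move=> x; rewrite opB opZ innerBl innerZl op_one innerxx subr_ge0.
  apply: complex_ler_addgt0 => d d0.
  have [s s0 Es] := ge0_complexE (`|x| ^+ 2) (exprn_ge0 2 (normr_ge0 x)).
  have s1 : 0 < s + 1 by rewrite ltr_wpDl.
  have [r Sr ar] := sup_adherent (divr_gt0 d0 s1) S0.
  have ra : r <= a by apply: (ub_le_sup S0.2).
  rewrite -/a in ar.
  have := Sr x; rewrite opB opZ innerBl innerZl op_one innerxx subr_ge0.
  rewrite Es (selfadjoint_real _ x hA) -!(rmorphM (real_complex R)) -rmorphD !lecR.
  move=> h; rewrite -lerBlDr; apply: le_trans h.
  rewrite lerBlDr -lerBlDl -mulrBl.
  have : (a - r) * s <= d / (s + 1) * (s + 1) by apply: ler_pM; lra.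
  by rewrite divfK ?gt_eqF.
have [B [B1 _]] := not_spectrum _ _ (hS a (Sneg _ Sa)).
set P := A - scalar_op a%:C in Sa B1.
have [c c0 hc] := bounded_op P; have [d d0 hd] := bounded_op B.
(* Since [x = B (P x)], the squared norm of [x] is at most [d ^+ 2 * c] times [inner (P x) x]; the
   added 1 keeps [k] positive. Hence [P >= k^-1]. *)
pose k := d ^+ 2 * c + 1; have k0 : 0 < k by rewrite ltr_wpDl// mulr_ge0// exprn_ge0.
have : S (a + k^-1).
  rewrite /S/= rmorphD/= scalar_opD opprD addrA -/P => x.
  rewrite opB opZ innerBl innerZl op_one innerxx subr_ge0.
  have hx : `|x| ^+ 2 <= (d ^+ 2 * c)%:C * inner (P x) x.
    rewrite rmorphM rmorphXn/= -mulrA.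
    apply: (@le_trans _ _ (d%:C ^+ 2 * `|P x| ^+ 2)).
      rewrite -exprMn lerXn2r// ?nnegrE ?mulr_ge0 ?ler0c//.
      by have := hd (P x); rewrite -opM B1 op_one.
    rewrite ler_wpM2l ?exprn_ge0 ?ler0c//; apply: positive_sqnorm_le => //.
    apply: bounded_positive_sub => //.
    by apply: selfadjointB => //; exact: selfadjoint_scalar.
  rewrite fmorphV mulrC ler_pdivrMr ?ltcR// mulrC.
  apply: le_trans hx _; rewrite ler_wpM2r//.
  by rewrite lecR lerDl.
move=> /(ub_le_sup S0.2); rewrite leNgt => /negP; apply.
by rewrite ltrDl invr_gt0.
Qed.

End Spectrum.

(** * Polynomials of an operator *)

Section PolynomialCalculus.
Context {R : realType} {H : hilbertType R}.
Implicit Types (A B P : 'B(H)) (x y : H) (z : R[i]) (t : R).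

(** Complex coefficients allow splitting into linear factors; [op_hornerE] embeds the real case. *)
Definition heval (p : {poly R[i]}) A : 'B(H) := \sum_(i < size p) p`_i *: A ^+ i.

Lemma heval_wide n (p : {poly R[i]}) A : (size p <= n)%N ->
  heval p A = \sum_(i < n) p`_i *: A ^+ i.
Proof.
move=> pn; rewrite /heval (big_ord_widen n (fun i => p`_i *: A ^+ i) pn).
rewrite big_mkcond; apply: eq_bigr => i _; case: ltnP => // /(nth_default 0) ->.
by rewrite scale0r.
Qed.

Lemma hevalD p q A : heval (p + q) A = heval p A + heval q A.
Proof.
rewrite (heval_wide (maxn (size p) (size q)) p) ?leq_maxl//.
rewrite (heval_wide (maxn (size p) (size q)) q) ?leq_maxr//.
rewrite (heval_wide (maxn (size p) (size q))) ?size_polyD// -big_split/=.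
by apply: eq_bigr => i _; rewrite coefD scalerDl.
Qed.

Lemma hevalZ z p A : heval (z *: p) A = z *: heval p A.
Proof.
rewrite (heval_wide (size p)) ?size_scale_leq// scaler_sumr.
by apply: eq_bigr => i _; rewrite coefZ scalerA.
Qed.

Lemma hevalC z A : heval z%:P A = scalar_op z.
Proof.
by rewrite (heval_wide 1) ?size_polyC_leq1// big_ord1 coefC eqxx expr0.
Qed.

Lemma hevalXM p A : heval ('X * p) A = A * heval p A.
Proof.
rewrite (heval_wide (size p).+1); last first.
  by rewrite (leq_trans (size_polyMleq _ _))// size_polyX.
rewrite big_ord_recl coefXM eqxx scale0r add0r mulr_sumr; apply: eq_bigr => i _.
by rewrite coefXM/= exprS op_scalerAr.
Qed.

Lemma hevalM p q A : heval (p * q) A = heval p A * heval q A.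
Proof.
elim/poly_ind: p => [|p c IH].
  by rewrite mul0r -(scale0r 0) hevalZ scale0r mul0r.
rewrite mulrDl !hevalD mulrDl hevalC mul_scalar_op mul_polyC hevalZ.
by rewrite -mulrA ['X * q]mulrC mulrA [p * q * 'X]mulrC [p * 'X]mulrC !hevalXM IH mulrA.
Qed.

Lemma hevalXsubC z A : heval ('X - z%:P) A = A - scalar_op z.
Proof.
rewrite -polyCN hevalD hevalC -['X]mulr1 hevalXM -polyC1 hevalC scalar_op1 mulr1.
by rewrite /scalar_op scaleNr.
Qed.

Lemma heval_invertible (q : {poly R[i]}) A : q != 0 ->
  (forall z, root q z -> ~ spectrum A z) -> op_invertible (heval q A).
Proof.
have [r Eq] := closed_field_poly_normal q => q0 hq.
rewrite Eq hevalZ; apply: op_invertibleZ; first by rewrite lead_coef_eq0.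
have {}hq z : z \in r -> ~ spectrum A z.
  move=> zr; apply: hq; rewrite Eq rootZ ?lead_coef_eq0//.
  by rewrite root_prod_XsubC.
elim: r hq {Eq} => [|z r IH] hq.
  rewrite big_nil -polyC1 hevalC scalar_op1; by exists 1; rewrite !mulr1.
rewrite big_cons hevalM hevalXsubC; apply: op_invertibleM.
  by apply/not_spectrum/hq; rewrite mem_head.
by apply: IH => u ur; apply: hq; rewrite in_cons ur orbT.
Qed.

Lemma op_hornerE (p : {poly R}) A : op_horner p A = heval (map_poly (real_complex R) p) A.
Proof.
rewrite /heval size_map_inj_poly ?rmorph0//; last exact: complexI.
by apply: eq_bigr => i _; rewrite coef_map.
Qed.

Lemma op_hornerD p q A : op_horner (p + q) A = op_horner p A + op_horner q A.
Proof. by rewrite !op_hornerE rmorphD/= hevalD. Qed.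

Lemma op_hornerM p q A : op_horner (p * q) A = op_horner p A * op_horner q A.
Proof. by rewrite !op_hornerE rmorphM/= hevalM. Qed.

Lemma op_hornerC t A : op_horner t%:P A = scalar_op t%:C.
Proof. by rewrite op_hornerE map_polyC/= hevalC. Qed.

Lemma op_hornerZ t p A : op_horner (t *: p) A = t%:C *: op_horner p A.
Proof. by rewrite -mul_polyC op_hornerM op_hornerC mul_scalar_op. Qed.

Lemma op_hornerB p q A : op_horner (p - q) A = op_horner p A - op_horner q A.
Proof. by rewrite -scaleN1r op_hornerD op_hornerZ rmorphN rmorph1 scaleN1r. Qed.

Lemma op_hornerX A : op_horner 'X A = A.
Proof.
by rewrite op_hornerE map_polyX -['X]mulr1 hevalXM -polyC1 hevalC scalar_op1 mulr1.
Qed.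

Lemma selfadjoint_horner p A : selfadjoint A -> selfadjoint (op_horner p A).
Proof.
move=> hA; rewrite /op_horner; elim: (size p) => [|n IH].
  by rewrite big_ord0 => x y; rewrite op0 inner0l inner_conj inner0l conjC0.
by rewrite big_ord_recr; apply: selfadjointD => //; apply/selfadjointZ/selfadjointX.
Qed.

(** One inclusion of the spectral mapping theorem: the roots of [p - t] in the spectrum of [A] would
    be real, and these are excluded. The polynomial must be nonzero to be factored. *)
Lemma op_horner_spectrum_real p A t : selfadjoint A ->
  map_poly (real_complex R) (p - t%:P) != 0 ->
  (forall s, spectrum A s%:C -> p.[s] != t) -> ~ spectrum (op_horner p A) t%:C.
Proof.
move=> hA q0 h; apply; rewrite -/(op_invertible _).
rewrite -(op_hornerC _ A) -op_hornerB op_hornerE; apply: heval_invertible => // z.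
move=> qz hz; have Ez := spectrum_real _ _ hA hz.
have := h (complex.Re z); rewrite -Ez => /(_ hz) /negP; apply.
by move: qz; rewrite Ez fmorph_root rootE !hornerE subr_eq0.
Qed.

Lemma op_horner_positive p A : selfadjoint A ->
  (forall t, spectrum A t%:C -> 0 <= p.[t]) -> positive_op (op_horner p A).
Proof.
(* For nonconstant [q] and any [t < 0], [q - t] is a nonzero polynomial without roots in the
   spectrum. *)
move=> hA; have nonconst (q : {poly R}) : (1 < size q)%N ->
    (forall t, spectrum A t%:C -> 0 <= q.[t]) -> positive_op (op_horner q A).
  move=> q1 h; apply: spectrum_positive; first exact: selfadjoint_horner.
  move=> t t0; apply: op_horner_spectrum_real => //.
    rewrite map_poly_eq0 subr_eq0; apply: contraTneq q1 => ->.
    by rewrite -leqNgt size_polyC_leq1.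
  by move=> s /h; apply: contraTneq => ->; rewrite -ltNge.
move=> h; have [/size1_polyC Ep|p1] := leqP (size p) 1; last exact: nonconst.
rewrite Ep op_hornerC; have [p0|p0] := leP 0 p`_0; first exact: positive_scalar.
(* The spectrum has no real point, so every [A - r] is positive and [H] is 0. *)
have nospec t : ~ spectrum A t%:C.
  by move=> /h; rewrite Ep hornerC leNgt p0.
have h1 : positive_op (op_horner ('X - 1%:P) A).
  by apply: nonconst => [|t /nospec//]; rewrite size_XsubC.
have h2 : positive_op (op_horner (- 'X) A).
  by apply: nonconst => [|t /nospec//]; rewrite size_polyN size_polyX.
(* The sum of [A - 1] and [- A] is [-1]; its positivity forces every vector to vanish. *)
have := positiveD _ _ h1 h2; rewrite -op_hornerD addrAC subrr add0r -polyCN op_hornerC.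
move=> h3 x; have := h3 x; rewrite !opZ !innerZl !op_one innerxx.
rewrite rmorphN rmorph1 mulN1r oppr_ge0 => x0.
have -> : `|x| ^+ 2 = 0 by apply/eqP; rewrite eq_le x0 exprn_ge0.
by rewrite mulr0.
Qed.

End PolynomialCalculus.

(** * The continuous functional calculus *)

Section Calculus.
Context {R : realType} {H : hilbertType R}.
Implicit Types (A B P : 'B(H)) (x y : H) (z : R[i]) (t c : R) (p : {poly R}).

Lemma opnorm_le A c : bounded_by A c -> 0 <= c -> opnorm A <= c.
Proof.
move=> hA c0; apply: ge_sup; first by exists (complex.Re `|A 0|); exists 0; rewrite //= normr0.
move=> _ [x /= x1 <-]; rewrite -lecR complexR_ge0//.
by apply: le_trans (hA x) _; rewrite ler_piMr// ler0c.
Qed.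

Lemma opnorm_bound A : bounded_by A (opnorm A).
Proof.
move=> x; have [->|x0] := eqVneq x 0; first by rewrite op_zero !normr0 mulr0.
have [s s0 Es] := ge0_complexE _ (normr_ge0 x).
have sp : 0 < s by rewrite -ltcR -Es normr_gt0.
have [c c0 hc] := bounded_op A.
rewrite Es mulrC -ler_pdivrMl ?ltcR// -fmorphV/=.
have -> : s^-1%:C * `|A x| = `|A (s^-1%:C *: x)|.
  by rewrite op_scale normrZ ger0_norm// ler0c invr_ge0.
rewrite -[`|A _|]complexR_ge0// lecR; apply: ub_le_sup; last first.
  exists (s^-1%:C *: x) => //=; rewrite normrZ Es ger0_norm ?ler0c ?invr_ge0//.
  by rewrite -(rmorphM (real_complex R)) mulVf ?gt_eqF.
exists c => _ [y /= y1 <-]; rewrite -lecR complexR_ge0//.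
by apply: le_trans (hc y) _; rewrite ler_piMr// ler0c.
Qed.

(** Positivity of [c ^+ 2 - p * p] at [A] compares the squared norms, as [op_horner p A] is
    self-adjoint. *)
Lemma op_horner_bounded p A c : selfadjoint A -> 0 <= c ->
  (forall t, spectrum A t%:C -> `|p.[t]| <= c) -> bounded_by (op_horner p A) c.
Proof.
move=> hA c0 h x; have hpA := selfadjoint_horner p A hA.
have : positive_op (op_horner ((c ^+ 2)%:P - p * p) A).
  apply: op_horner_positive => // t /h tc.
  by rewrite !hornerE -expr2 subr_ge0 -real_normK ?num_real// lerXn2r// nnegrE.
move=> /(_ x); rewrite op_hornerB op_hornerC op_hornerM opB opM opZ op_one.
rewrite innerBl innerZl hpA !innerxx subr_ge0 => h2.
rewrite -(ler_pXn2r (n:=2))// ?nnegrE ?mulr_ge0 ?ler0c//.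
by rewrite exprMn -(rmorphXn (real_complex R)).
Qed.

Lemma complex_closed_ge0 z : (forall d : R, 0 < d -> exists2 r : R[i],
  0 <= r & `|r - z| <= d%:C) -> 0 <= z.
Proof.
move=> h; rewrite lecE/=; apply/andP; split.
  rewrite -normr_eq0 eq_le normr_ge0 andbT.
  apply/ler_addgt0Pr => d d0; rewrite add0r -lecR.
  have [r r0 rz] := h d d0; apply: le_trans rz.
  (* Multiplying by ['i%C] turns the bound on real parts into one on imaginary parts. *)
  have := normc_ge_Re ((r - z) * 'i%C).
  rewrite normrM ReiNIm normrN; have -> : `|'i%C| = 1 :> R[i].
    by rewrite normc_def/= expr0n/= add0r expr1n sqrtr1.
  rewrite mulr1 => /(le_trans _); apply.
  by rewrite raddfB/= (ger0_Im r0) sub0r normrN.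
apply/ler_addgt0Pr => d d0; rewrite -lerBlDr sub0r.
have [r r0 rz] := h d d0; have := le_trans (normc_ge_Re _) rz.
rewrite lecR raddfB/= ler_norml => /andP[_].
have : 0 <= complex.Re r by rewrite -ler0c complexR_ge0.
by lra.
Qed.

Lemma positive_closed P : (forall e : R, 0 < e -> exists2 A,
  positive_op A & bounded_by (A - P) e) -> positive_op P.
Proof.
move=> h x; apply: complex_closed_ge0 => d d0.
have [s s0 Es] := ge0_complexE (`|x| ^+ 2) (exprn_ge0 2 (normr_ge0 x)).
have s1 : 0 < s + 1 by rewrite ltr_wpDl.
have [A hA hAP] := h _ (divr_gt0 d0 s1).
exists (inner (A x) x); first exact: hA.
rewrite -innerBl -opB; apply: le_trans (cauchy_schwarz _ _) _.
apply: (@le_trans _ _ ((d / (s + 1))%:C * `|x| ^+ 2)).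
  by rewrite expr2 mulrA ler_wpM2r// -opB.
rewrite Es -(rmorphM (real_complex R)) lecR mulrAC ler_pdivrMr// ler_wpM2l ?ltW//.
by rewrite ltrDl.
Qed.

Lemma bounded_by_scalar c : 0 <= c -> bounded_by (scalar_op c%:C : 'B(H)) c.
Proof. by move=> c0 x; rewrite opZ op_one normrZ ger0_norm// ler0c. Qed.

(** If [q] approximates [f] within [e / 2], then [p + e / 2 - q] is nonnegative on the spectrum, and
    its value at [A] is within [e] of [op_horner p A - B]. Positivity is closed under norm
    limits. *)
Lemma is_cfc_le_horner (f : R -> R) A B p : selfadjoint A -> is_cfc f A B ->
  (forall t, spectrum A t%:C -> f t <= p.[t]) -> B <=L op_horner p A.
Proof.
move=> hA hB fp; apply: positive_closed => e e0.
have e2 : 0 < e / 2 by rewrite divr_gt0.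
have [q [fq qB]] := hB _ e2.
exists (op_horner (p + (e / 2)%:P - q) A).
  apply: op_horner_positive => // t ht; rewrite !hornerE.
  by have := fp t ht; have := fq t ht; rewrite ler_norml => /andP[]; lra.
rewrite op_hornerB op_hornerD op_hornerC.
have -> : op_horner p A + scalar_op (e / 2)%:C - op_horner q A - (op_horner p A - B) =
    scalar_op (e / 2)%:C - (op_horner q A - B).
  move: (op_horner p A) (op_horner q A) (scalar_op _) => X Y Z.
  rewrite !opprB [X + Z]addrC [Z + X - Y]addrAC -[Z - Y + X + _]addrA.
  by rewrite [X + (B - X)]addrC subrK [B - Y]addrC addrA.
rewrite [e in bounded_by _ e]splitr.
apply: bounded_byD; first exact/bounded_by_scalar/ltW.
by apply: bounded_byN; apply: bounded_by_le qB _; exact: opnorm_bound.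
Qed.

Lemma is_cfc_ge_horner (f : R -> R) A B p : selfadjoint A -> is_cfc f A B ->
  (forall t, spectrum A t%:C -> p.[t] <= f t) -> op_horner p A <=L B.
Proof.
move=> hA hB fp; apply: positive_closed => e e0.
have e2 : 0 < e / 2 by rewrite divr_gt0.
have [q [fq qB]] := hB _ e2.
exists (op_horner (q + (e / 2)%:P - p) A).
  apply: op_horner_positive => // t ht; rewrite !hornerE.
  by have := fp t ht; have := fq t ht; rewrite ler_norml => /andP[]; lra.
rewrite op_hornerB op_hornerD op_hornerC.
have -> : op_horner q A + scalar_op (e / 2)%:C - op_horner p A - (B - op_horner p A) =
    scalar_op (e / 2)%:C + (op_horner q A - B).
  by rewrite opprB addrA subrK [op_horner q A + _]addrC addrA.
rewrite [e in bounded_by _ e]splitr.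
apply: bounded_byD; first exact/bounded_by_scalar/ltW.
by apply: bounded_by_le qB _; exact: opnorm_bound.
Qed.

(** Uniform approximations of [f] by polynomials become a Cauchy sequence of operators, since sup
    bounds on the spectrum are norm bounds. *)
Lemma ex_cfc (f : R -> R) A (a b : R) : a < b -> selfadjoint A ->
  spectrum A `<=` [set t%:C | t in `[a, b]] -> {within `[a, b], continuous f} ->
  exists B, is_cfc f A B.
Proof.
move=> ab hA hS fc.
have {}hS t : spectrum A t%:C -> t \in `[a, b].
  by move=> /hS[s /= sab /complexI <-].
have h0 (n : nat) : 0 < n.+1%:R^-1 :> R by rewrite invr_gt0.
have /choice[p hp] : forall n : nat, exists p : {poly R},
    forall t, t \in `[a, b] -> `|f t - p.[t]| <= n.+1%:R^-1.
  by move=> n; exact: weierstrass_approximation.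
(* The factor 2 comes from comparing [p n] and [p k], for [n <= k], through [f]. *)
pose e (n : nat) : R := 2 * n.+1%:R^-1.
have e0 : e @ \oo --> 0.
  rewrite -[X in _ --> X](mulr0 2); apply: cvgMr; exact: cvg_harmonic.
have [n k nk|B hB] := op_complete (fun n => op_horner (p n) A) e e0.
  rewrite -op_hornerB; apply: op_horner_bounded => //; first by rewrite mulr_ge0// ltW.
  move=> t /hS tab; rewrite hornerD hornerN.
  have := ler_distD (f t) (p n).[t] (p k).[t]; rewrite (distrC _ (f t)).
  have := hp n t tab; have := hp k t tab.
  have : k.+1%:R^-1 <= n.+1%:R^-1 :> R by rewrite lef_pV2 ?posrE// ler_nat.
  by rewrite /e; move: (k.+1%:R^-1) (n.+1%:R^-1) => u v; lra.
exists B => d d0.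
have /cvgrPdist_lt/(_ _ d0)[N _ /(_ N (leqnn _))/=] := e0.
rewrite sub0r normrN ger0_norm => [eN|]; last by rewrite mulr_ge0// ltW.
exists (p N); split.
  move=> t /hS tab; have := hp N t tab; have := h0 N; move: eN; rewrite /e.
  by move: (N.+1%:R^-1) => u; lra.
apply: opnorm_le; last exact: ltW.
by apply: bounded_by_le (hB N); exact: ltW.
Qed.

Lemma cfcP (f : R -> R) A (a b : R) : a < b -> selfadjoint A ->
  spectrum A `<=` [set t%:C | t in `[a, b]] -> {within `[a, b], continuous f} ->
  is_cfc f A (cfc f A).
Proof.
by move=> ab hA hS fc; exact: xgetPex (ex_cfc f A a b ab hA hS fc).
Qed.

Lemma loewner_trans A B P : A <=L B -> B <=L P -> A <=L P.
Proof. by move=> AB BP; have := positiveD _ _ BP AB; rewrite addrA subrK. Qed.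

Lemma loewner_wpZ c A B : 0 <= c -> A <=L B -> c%:C *: A <=L c%:C *: B.
Proof. by move=> c0 AB; rewrite /loewner_le -scalerBr; exact: positiveZ. Qed.

End Calculus.

(** * Positive unital linear maps *)

Section PositiveUnital.
Context {R : realType} {H K : hilbertType R}.
Variable Phi : {linear 'B(H) -> 'B(K)}.
Hypotheses (hPhi : positive_map Phi) (hPhi1 : unital_map Phi).
Implicit Types A B : 'B(H).

Lemma loewner_positive_map A B : A <=L B -> Phi A <=L Phi B.
Proof. by move=> AB; rewrite /loewner_le -linearB; exact: hPhi. Qed.

Lemma unital_scalar z : Phi (scalar_op z) = scalar_op z.
Proof. by rewrite linearZ/= hPhi1. Qed.

(** Write [A = c - (c - A)] with [c] a bound of [A]: the second term is positive, so its image is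
    positive and hence self-adjoint. *)
Lemma selfadjoint_positive_map A : selfadjoint A -> selfadjoint (Phi A).
Proof.
move=> hA; have [c c0 hc] := bounded_op A.
rewrite -[A](subKr (scalar_op c%:C)) linearB/= unital_scalar.
apply: selfadjointB; first exact: selfadjoint_scalar.
by apply: positive_selfadjoint; apply: hPhi; exact: bounded_positive_sub.
Qed.

(** The spectral inclusion amounts to [m <= A <= M], and [Phi] preserves these operator bounds; this
    makes [f] applicable to [Phi A]. *)
Lemma spectrum_positive_map A (m M : R) : selfadjoint A ->
  spectrum A `<=` [set t%:C | t in `[m, M]] ->
  spectrum (Phi A) `<=` [set t%:C | t in `[m, M]].
Proof.
move=> hA hS z hz.
have {}hS t : spectrum A t%:C -> m <= t <= M.
  by move=> /hS[s /= + /complexI <-]; rewrite in_itv.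
have Ez := spectrum_real _ _ (selfadjoint_positive_map _ hA) hz.
exists (complex.Re z) => //=; rewrite Ez in hz; rewrite in_itv/=; apply/andP; split.
  apply: spectrum_ge hz; rewrite -unital_scalar -linearB; apply: hPhi.
  rewrite -(op_hornerC _ A) -[X in X - _]op_hornerX -op_hornerB.
  by apply: op_horner_positive => // t /hS/andP[mt _]; rewrite !hornerE subr_ge0.
apply: spectrum_le hz; rewrite -unital_scalar -linearB; apply: hPhi.
rewrite -(op_hornerC _ A) -[X in _ - X]op_hornerX -op_hornerB.
by apply: op_horner_positive => // t /hS/andP[_ tM]; rewrite !hornerE subr_ge0.
Qed.

End PositiveUnital.

Theorem theorem2p2 (R : realType) (H K : hilbertType R)
  (I : set R) (hI : is_interval I) (A : 'B(H)) (hA : selfadjoint A)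
  (m M : R) (hmM : m < M)
  (hSp : spectrum A `<=` [set t%:C | t in `[m, M]]) (hmMI : `[m, M] `<=` I)
  (f : R -> R) (hfpos : forall t, t \in `[m, M] -> 0 < f t)
  (hfcont : {within `[m, M], continuous f})
  (hfdiff : twice_derivable_in `[m, M] f)
  (alpha : R)
  (halpha : forall t, t \in `[m, M] ->
     alpha <= derive_in `[m, M] (derive_in `[m, M] f) t)
  (Phi : {linear 'B(H) -> 'B(K)})
  (hPhi_pos : positive_map Phi) (hPhi1 : unital_map Phi) :
  ((Kmax m M f)^-1)%:C *:
      (Phi (cfc f A) +
       (alpha / 2)%:C *:
         ((M + m)%:C *: Phi A - scalar_op (M * m)%:C - Phi (A ^+ 2)))
    <=L cfc f (Phi A)
  /\
  cfc f (Phi A)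
    <=L (Kmax m M f)%:C *: Phi (cfc f A) -
        (alpha / 2)%:C *:
          ((M + m)%:C *: Phi A - scalar_op (M * m)%:C - Phi A ^+ 2).
Proof.
set B := Phi A; set X := cfc f A; set Y := cfc f B.
have hB : selfadjoint B by exact: selfadjoint_positive_map.
have hSB : spectrum B `<=` [set t%:C | t in `[m, M]] by exact: spectrum_positive_map.
have hX : is_cfc f A X by exact: cfcP hmM hA hSp hfcont.
have hY : is_cfc f B Y by exact: cfcP hmM hB hSB hfcont.
have inS (E : hilbertType R) (T : 'B(E)) t :
    spectrum T `<=` [set t%:C | t in `[m, M]] -> spectrum T t%:C -> t \in `[m, M].
  by move=> hT /hT[s /= smM /complexI <-].
have Mm : M - m != 0 by rewrite subr_eq0 gt_eqF.
(* [L] is the chord of [f] in monomial form, and [Q] is [(M - t) * (t - m)] expanded. *)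
pose L : {poly R} := ((M * f m - m * f M) / (M - m))%:P + ((f M - f m) / (M - m)) *: 'X.
pose Q : {poly R} := (M + m) *: 'X - (M * m)%:P - 'X * 'X.
have LE t : L.[t] = (M - t) / (M - m) * f m + (t - m) / (M - m) * f M.
  by rewrite !hornerE; field.
have QE t : Q.[t] = (M - t) * (t - m) by rewrite !hornerE; ring.
have QopE (E : hilbertType R) (T : 'B(E)) :
    op_horner Q T = (M + m)%:C *: T - scalar_op (M * m)%:C - T ^+ 2.
  by rewrite !op_hornerB op_hornerM op_hornerZ op_hornerC op_hornerX expr2.
have PhiL : Phi (op_horner L A) = op_horner L B.
  rewrite !op_hornerD !op_hornerC !op_hornerZ !op_hornerX linearD/=.
  by rewrite unital_scalar// [Phi (_ *: A)]linearZ.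
(* Unlike the affine [L], the quadratic [Q] does not pass through [Phi]: here [Phi (A ^+ 2)]
   remains, whereas [Q] at [B] yields [B ^+ 2]. This is the difference between the two brackets of
   the theorem. *)
have PhiQ : Phi (op_horner Q A) =
    (M + m)%:C *: B - scalar_op (M * m)%:C - Phi (A ^+ 2).
  by rewrite QopE !linearB/= unital_scalar// [Phi (_ *: A)]linearZ.
pose K0 := Kmax m M f; have K0gt0 : 0 < K0 by exact: Kmax_gt0.
have chord t : t \in `[m, M] -> f t <= (L - (alpha / 2) *: Q).[t].
  by move=> tmM; rewrite hornerD hornerN hornerZ LE QE; exact: le_chord.
have ratio t : t \in `[m, M] -> (K0^-1 *: L).[t] <= f t.
  by move=> tmM; rewrite hornerZ LE mulrC ler_pdivrMr// [leRHS]mulrC le_Kmax.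
have opL (E : hilbertType R) (T : 'B(E)) : op_horner (L - (alpha / 2) *: Q) T =
    op_horner L T - (alpha / 2)%:C *: op_horner Q T.
  by rewrite op_hornerB op_hornerZ.
split.
  (* First inequality: the chord bound is used at [A] and carried over by [Phi], then the ratio
     bound is used at [B]. *)
  have h1 : Phi X + (alpha / 2)%:C *: Phi (op_horner Q A) <=L op_horner L B.
    have : X <=L op_horner (L - (alpha / 2) *: Q) A.
      by apply: is_cfc_le_horner hX _ => // t /inS tS; apply/chord/tS.
    move=> /(loewner_positive_map _ hPhi_pos).
    rewrite opL linearB linearZ/= PhiL /loewner_le.
    by rewrite opprD addrA [X in positive_op X -> _]addrAC.
  rewrite -PhiQ; apply: loewner_trans (_ : _ <=L K0^-1%:C *: op_horner L B) _.
    by apply: loewner_wpZ => //; rewrite invr_ge0 ltW.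
  rewrite -op_hornerZ; apply: is_cfc_ge_horner hY _ => // t /inS tS.
  exact/ratio/tS.
(* Second inequality, with the roles exchanged: the chord bound at [B], then the ratio bound at [A]
   carried over by [Phi] and multiplied by [K0]. *)
rewrite -QopE; apply: loewner_trans (_ : _ <=L op_horner L B - (alpha / 2)%:C *: op_horner Q B) _.
  by rewrite -opL; apply: is_cfc_le_horner hY _ => // t /inS tS; apply/chord/tS.
have h2 : K0^-1%:C *: op_horner L A <=L X.
  by rewrite -op_hornerZ; apply: is_cfc_ge_horner hX _ => // t /inS tS; apply/ratio/tS.
have := loewner_wpZ K0 _ _ (ltW K0gt0) (loewner_positive_map _ hPhi_pos _ _ h2).
rewrite linearZ/= PhiL scalerA -(rmorphM (real_complex R)) mulfV ?gt_eqF// scale1r.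
rewrite /loewner_le => h3.
by rewrite opprB addrA subrK.
Qed.
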